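(* Let $p\in[1,\infty]$ and let $V$ be an infinite dimensional closed subalgebra of $\ell_p$, where $\ell_p$ carries the coordinatewise product. Then $V\setminus Z(V)$ is algebrable in $V$; that is, there is a subalgebra $\mathcal{C}$ of $V$ with $\mathcal{C}\subset (V\setminus Z(V))\cup\{0\}$ such that every system of generators of $\mathcal{C}$ is infinite.
   Context: All sequence spaces are over $\mathbb{C}$. For a space $V$ of sequences, $Z(V)$ denotes the set of all sequences in $V$ having only finitely many zero coordinates. A system of generators of an algebra $\mathcal{C}$ is a subset $S\subset\mathcal{C}$ such that the smallest subalgebra of $\mathcal{C}$ containing $S$ is $\mathcal{C}$; algebras are not required to be unital and no closure is taken. *)

(* Defs.v *)
From HB Require Import structures.
From mathcomp Require Import all_boot all_order all_algebra.
From mathcomp Require Import complex.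
From mathcomp Require Import all_classical all_reals all_analysis.
Set Implicit Arguments.
Unset Strict Implicit.
Unset Printing Implicit Defensive.
Import Order.TTheory GRing.Theory Num.Theory.
Local Open Scope classical_set_scope.
Local Open Scope ring_scope.

Section SequenceSpaces.
Variable R : realType.

Local Notation cseq := (nat -> R[i]).

(* [ComplexField.Normc.normc] is the [R]-valued modulus; the generic norm
   [`|z|] on [R[i]] is [R[i]]-valued. For [p = +oo] the essential supremum
   with respect to [counting] is the supremum over all indices. *)
Definition lp_norm (p : \bar R) (x : cseq) : \bar R :=
  Lnorm counting p (fun n => (ComplexField.Normc.normc (x n))%:E).

Definition lp (p : \bar R) : set cseq := [set x | (lp_norm p x < +oo)%E].

(* [A] contains every point of [lp p] that is adherent to it for the metric
   [lp_norm p (x - a)]. *)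
Definition lp_closed (p : \bar R) (A : set cseq) : Prop :=
  forall x, lp p x ->
    (forall e : R, 0 < e -> exists2 a, A a & (lp_norm p (x - a)%R < e%:E)%E) ->
  A x.

(* Subalgebras need not contain the constant sequence [1], hence not
   [subalg_closed]; the product of [nat -> R[i]] is coordinatewise. *)
Definition subalgebra (A : set cseq) : Prop :=
  GRing.submod_closed (mem A) /\ GRing.mulr_2closed (mem A).

Definition finite_dimensional (A : set cseq) : Prop :=
  exists (n : nat) (b : 'I_n -> cseq), (forall i, A (b i)) /\
    forall x, A x -> exists c : 'I_n -> R[i], x = \sum_(i < n) c i *: b i.

Definition infinite_dimensional (A : set cseq) : Prop :=
  ~ finite_dimensional A.

Definition generators (C S : set cseq) : Prop :=
  S `<=` C /\ smallest [set B | subalgebra B /\ B `<=` C] S = C.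

Definition algebrable (M V : set cseq) : Prop :=
  exists C : set cseq, [/\ subalgebra C, C `<=` V, C `<=` M `|` [set 0] &
    forall S, generators C S -> infinite_set S].

Definition Zset (V : set cseq) : set cseq :=
  [set x | V x /\ finite_set [set n | x n = 0]].

End SequenceSpaces.

(* Main.v *)
Require Import Defs.
From HB Require Import structures.
From mathcomp Require Import all_boot all_order all_algebra.
From mathcomp Require Import complex.
From mathcomp Require Import all_classical all_reals all_analysis.
From mathcomp Require Import ess_sup_inf lra.
Set Implicit Arguments.
Unset Strict Implicit.
Unset Printing Implicit Defensive.
Import Order.TTheory GRing.Theory Num.Theory.
Local Open Scope classical_set_scope.
Local Open Scope ring_scope.

(** A subalgebra that is the union of a strictly increasing sequence of
    subalgebras is not finitely generated, since a finite set already lies in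
    one of them. Let [n_ 0 < n_ 1 < ...] be indices and [C] the set of those
    [f] in [V] that vanish at [n_ j] for all large [j]. It is the union of
    the subalgebras [C_ K] of those [f] that vanish at [n_ j] for all
    [j >= K], and every member of it has infinitely many zeros. The inclusions
    do not become stationary as soon as, for every [k], some [g k] in [V]
    satisfies [g k (n_ k) != 0] and [g k (n_ j) = 0] for all [j > k]
    (lemma [algebrable_of_staircase]).

    Such a staircase is built by a gliding hump (lemma [staircase]). The
    functions [g 0], ..., [g (i - 1)] are known approximately at stage [i].
    One chooses a new index [n_ i], subtracts from each of them a function
    of norm at most [2^-(i+1)] that agrees with it at [n_ i] and vanishes on
    an initial segment containing all previous indices, and starts [g i]. The
    sums converge in norm, so the limits stay in the closed set [V]; they are
    also eventually constant at each coordinate, which makes the zeros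
    obtained at each stage permanent. What is needed is that such small
    corrections exist (definition [correctable]). Infinite dimension supplies
    nonzero [f] in [V] vanishing on any given initial segment, and these can
    be normalised so that [f n = 1] and [|f| <= 2] (lemma [exists_peak]).

    For [p < +oo] the product [s * f] corrects [s] at [n]: if [f] vanishes on
    a long initial segment, this product is bounded by twice a tail of [s],
    hence has small norm.

    For [p = +oo] tails need not be small, but a multiple [s n *: h] of a
    function with [h n = 1] is small as soon as [s n] is. Choose an ultrafilter
    [U] containing the set of peaks beyond [N] for every [N], and let [W] be
    the set of members of [V] that tend to [0] along [U]. Finitely many members
    of [W] are simultaneously small at some peak [n], so it suffices to modify
    the peaking function [f] into a uniformly bounded [h] in [W]
    (lemma [exists_null_peak]). With [l] the limit of [f] along [U], this is
    a multiple of [f * (f - l)] if [l] is away from [1]; if two successive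
    peaking functions [f], [f'] have limits [l], [l'] near [1], it is
    [f - (l / l') f']. *)

(** * The norms of the sequence spaces *)

Section LpNorm.
Variable R : realType.
Local Notation cseq := (nat -> R[i]).
Local Notation normc := (@ComplexField.Normc.normc R).
Implicit Types (x y : cseq) (p : \bar R).

Lemma normc_ge0 (z : R[i]) : 0 <= normc z.
Proof. by case: z => a b; exact: sqrtr_ge0. Qed.

Lemma lp_norm_poweR (r : R) x : 0 < r ->
  (lp_norm r%:E x `^ r = \sum_(k <oo) (normc (x k) `^ r)%:E)%E.
Proof.
move=> r0; rewrite /lp_norm Lnorm_counting// -poweRrM mulVf ?gt_eqF//.
rewrite poweRe1; last by apply: nneseries_ge0 => k _ _; exact: poweR_ge0.
by apply: eq_eseriesr => k _ /=; rewrite ger0_norm ?normc_ge0.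
Qed.

(** Bounding all partial sums instead of the series makes the elementary
    properties of the norm statements about finite sums. *)
Lemma lp_norm_fin_leP (r : R) x (a : R) : 0 < r -> 0 <= a ->
  (lp_norm r%:E x <= a%:E)%E <->
  forall M, \sum_(0 <= k < M) normc (x k) `^ r <= a `^ r.
Proof.
move=> r0 a0.
split=> [xa M|xa].
  have : (lp_norm r%:E x `^ r <= a%:E `^ r)%E.
    apply: gt0_ler_poweR => //; first exact: ltW.
      by rewrite in_itv/= Lnorm_ge0 leey.
    by rewrite in_itv/= lee_fin a0 leey.
  rewrite lp_norm_poweR// -lee_fin -sumEFin; apply: le_trans.
  by apply: nneseries_lim_ge => n _ _; rewrite lee_fin powR_ge0.
have : (lp_norm r%:E x `^ r <= a%:E `^ r)%E.
  rewrite lp_norm_poweR//; apply: lime_le.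
    by apply: is_cvg_nneseries => n _ _; rewrite lee_fin powR_ge0.
  by apply: nearW => M; rewrite sumEFin lee_fin.
move=> /(gt0_ler_poweR (r := r^-1)); rewrite !in_itv/=.
rewrite invr_ge0 (ltW r0) poweR_ge0 leey lee_fin powR_ge0 leey.
rewrite -!poweRrM divff ?gt_eqF// poweRe1 ?Lnorm_ge0//.
rewrite -powRrM divff ?gt_eqF// powRr1//; exact.
Qed.

Lemma counting_nat_gt0 : (0 < @counting nat R setT)%E.
Proof.
rewrite /counting asboolF ?ltry//.
exact/infiniteP/card_lexx.
Qed.

(** The counting measure has no nonempty null set, so that the essential
    supremum is a supremum. *)
Lemma ae_counting (P : nat -> Prop) :
  (\forall n \ae @counting nat R, P n) <-> forall n, P n.
Proof.
split=> [[N [_ N0 sub]] n|]; last exact: nearW.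
apply: contrapT => Pn; have Nn : N n by exact: sub.
move: N0; rewrite /counting; case: asboolP => // finN /eqP.
rewrite eqe pnatr_eq0 finmap.cardfs_eq0 => /eqP N0.
by have := mem_set Nn; rewrite -in_fset_set// N0.
Qed.

Lemma lp_norm_sup_leP x (a : R) :
  (lp_norm +oo x <= a%:E)%E <-> forall n, normc (x n) <= a.
Proof.
rewrite /lp_norm unlock /Lnorm counting_nat_gt0; split=> [/ess_supP|] xa.
  by move/ae_counting: xa => xa n; move: (xa n); rewrite /= ger0_norm ?normc_ge0.
apply/ess_supP; apply: nearW => n; rewrite /= ger0_norm ?normc_ge0 ?lee_fin//; exact: xa.
Qed.

Lemma lp_norm_ge0 p x : (0 <= lp_norm p x)%E.
Proof. exact: Lnorm_ge0. Qed.

(** The norm is lower semicontinuous for coordinatewise convergence; only the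
    case of approximants that agree with [x] on longer and longer initial
    segments is needed, where no limit has to be taken. *)
Lemma lp_norm_local p x (a : R) : (1 <= p)%E -> 0 <= a ->
  (forall M, exists2 y, (forall n, (n < M)%N -> y n = x n) &
     (lp_norm p y <= a%:E)%E) ->
  (lp_norm p x <= a%:E)%E.
Proof.
case: p => [r||]//; rewrite ?lee_fin => r1 a0 loc.
  have r0 : 0 < r by rewrite (lt_le_trans _ r1).
  apply/lp_norm_fin_leP => // M; have [y yx /lp_norm_fin_leP] := loc M.
  move=> /(_ r0 a0 M); rewrite !big_mkord.
  by under eq_bigr do rewrite yx//.
apply/lp_norm_sup_leP => n; have [y yx /lp_norm_sup_leP/(_ n)] := loc n.+1.
by rewrite yx.
Qed.

Lemma lp_norm_le p x y : (1 <= p)%E -> (forall n, normc (x n) <= normc (y n)) ->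
  (lp_norm p x <= lp_norm p y)%E.
Proof.
move=> p1 xy; have := lp_norm_ge0 p y.
case E : (lp_norm p y) => [a||]//; last by move=> _; rewrite leey.
rewrite lee_fin => a0.
have : (lp_norm p y <= a%:E)%E by rewrite E.
case: p p1 {E} => [r||]//; rewrite ?lee_fin => r1.
  have r0 : 0 < r by rewrite (lt_le_trans _ r1).
  move=> /lp_norm_fin_leP -/(_ r0 a0) ya; apply/lp_norm_fin_leP => // M.
  apply: le_trans (ya M); apply: ler_sum => k _.
  by apply: ge0_ler_powR; rewrite ?nnegrE ?normc_ge0 ?(ltW r0).
by move=> /lp_norm_sup_leP ya; apply/lp_norm_sup_leP => n; apply: le_trans (ya n).
Qed.

(** Minkowski's inequality for real functions applies to the moduli, which
    form again a complex sequence [f + g] dominating [x + y]. *)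
Lemma lp_normD p x y : (1 <= p)%E ->
  (lp_norm p (x + y)%R <= lp_norm p x + lp_norm p y)%E.
Proof.
move=> p1.
pose f n := (normc (x n))%:C%C : R[i]; pose g n := (normc (y n))%:C%C : R[i].
have nC (a : R) : 0 <= a -> normc a%:C%C = a.
  by move=> a0; rewrite /= expr0n addr0 sqrtr_sqr ger0_norm.
have : (Lnorm counting p (EFin \o ((normc \o x) \+ (normc \o y))%R) <=
    lp_norm p x + lp_norm p y)%E by exact: eminkowski.
apply: le_trans.
have fg n : normc ((f + g) n) = normc (x n) + normc (y n).
  rewrite -[(f + g) n]/(f n + g n) /f /g -rmorphD.
  by rewrite nC ?addr_ge0 ?normc_ge0.
apply: (@le_trans _ _ (lp_norm p (f + g)%R)).
  by apply: lp_norm_le => // n; rewrite fg; exact: le_normcD.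
by rewrite /lp_norm le_eqVlt; apply/orP; left; apply/eqP/eq_Lnorm => n; rewrite fg.
Qed.

Lemma lp_coord p x n : (1 <= p)%E -> ((normc (x n))%:E <= lp_norm p x)%E.
Proof.
move=> p1; have := lp_norm_ge0 p x.
case E : (lp_norm p x) => [a||]//; last by move=> _; rewrite leey.
rewrite !lee_fin => a0; have : (lp_norm p x <= a%:E)%E by rewrite E.
case: p p1 {E} => [r||]//; rewrite ?lee_fin => r1; last by move/lp_norm_sup_leP.
have r0 : 0 < r by rewrite (lt_le_trans _ r1).
move=> /lp_norm_fin_leP -/(_ r0 a0 n.+1); rewrite big_nat_recr//= => h.
have {}h : normc (x n) `^ r <= a `^ r.
  apply: le_trans h; rewrite lerDr; apply: sumr_ge0 => k _; exact: powR_ge0.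
rewrite leNgt; apply/negP => /(gt0_ltr_powR r0); rewrite !nnegrE.
by move=> /(_ a0 (normc_ge0 _)); rewrite ltNge h.
Qed.

Lemma lp_bounded p x : (1 <= p)%E -> lp p x -> exists a : R, forall n, normc (x n) <= a.
Proof.
move=> p1; rewrite /lp/= => xp; exists (fine (lp_norm p x)) => n.
by rewrite -lee_fin fineK ?lp_coord// ge0_fin_numE ?lp_norm_ge0.
Qed.

Definition tail N x : cseq := fun n => if (N <= n)%N then x n else 0.

Lemma tail_lt N x n : (n < N)%N -> tail N x n = 0.
Proof. by move=> nN; rewrite /tail leqNgt nN. Qed.

Lemma lp_tail (r : R) x (e : R) : 1 <= r -> lp r%:E x -> 0 < e ->
  exists N0, forall N, (N0 <= N)%N -> (lp_norm r%:E (tail N x) <= e%:E)%E.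
Proof.
move=> r1 xp e0; have r0 : 0 < r by rewrite (lt_le_trans _ r1).
have xp' : (\sum_(k <oo) (normc (x k) `^ r)%:E < +oo)%E.
  by rewrite -lp_norm_poweR// poweR_lty.
(* The tails of the convergent series of [r]-th powers tend to zero. *)
have er0 : 0 < e `^ r by exact: powR_gt0.
have f0 k : true -> (0 <= (normc (x k) `^ r)%:E)%E by rewrite lee_fin powR_ge0.
have := nneseries_tail_cvg xp' f0.
move=> /fine_cvgP [fin /cvgrPdist_lt/(_ _ er0)] ev.
have [N0 _ H] : \forall N \near \oo,
   (\sum_(N <= k <oo) (normc (x k) `^ r)%:E <= (e `^ r)%:E)%E.
  near=> N.
  rewrite -[X in (X <= _)%E]fineK; last by near: N; exact: fin.
  rewrite lee_fin; apply/ltW/(le_lt_trans (ler_norm _)).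
  rewrite -normrN -[X in `|X|]add0r; near: N; exact: ev.
exists N0 => N NN0; apply/lp_norm_fin_leP => //; first exact: ltW.
move=> M; rewrite -lee_fin; apply: le_trans (H N NN0).
have [MN|NM] := leqP M N.
  rewrite big_nat big1; first by apply: nneseries_ge0 => k _ _; exact: f0.
  move=> k /andP[_ kM].
  by rewrite tail_lt ?(leq_trans kM)// ComplexField.Normc.normc0 powR0 ?gt_eqF.
rewrite (big_cat_nat (n := N))//=; last exact: ltnW.
rewrite big_nat big1 ?add0r; last first.
  by move=> k /andP[_ kN]; rewrite tail_lt// ComplexField.Normc.normc0 powR0 ?gt_eqF.
rewrite -sumEFin; apply: le_trans (nneseries_lim_ge M _) => //.
  rewrite big_nat [leRHS]big_nat; apply: lee_sum => k /andP[Nk _].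
  by rewrite /tail Nk.
by move=> n _ _; exact: f0.
Unshelve. all: by end_near. Qed.

End LpNorm.

(** * Infinitely generated algebras of sequences *)

(** Used for finite generating systems, and for finite sets of zeros in the
    union of the initial segments. *)
Lemma finite_sub_bigcup (T : choiceType) (S : set T) (C : nat -> set T) :
  (forall K L, (K <= L)%N -> C K `<=` C L) -> finite_set S ->
  S `<=` \bigcup_K C K -> exists K, S `<=` C K.
Proof.
move=> C_mono /finite_seqP[s ->{S}]; elim: s => [|x s IH] sub.
  by exists 0%N.
have [|K sK] := IH; first by move=> y ys; apply: sub; rewrite /= inE ys orbT.
have [|L _ xL] := sub x; first by rewrite /= mem_head.
exists (maxn K L) => y; rewrite /= inE => /predU1P[->|/sK].
  by apply: C_mono xL; exact: leq_maxr.
by apply: C_mono; exact: leq_maxl.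
Qed.

Section Algebra.
Variable R : realType.
Local Notation cseq := (nat -> R[i]).
Local Notation normc := (@ComplexField.Normc.normc R).
Implicit Types (V W : set cseq) (x y f : cseq).

Lemma subalgebraP V : subalgebra V <->
  [/\ V 0, (forall (c : R[i]) x y, V x -> V y -> V (c *: x + y)) &
      forall x y, V x -> V y -> V (x * y)].
Proof.
split=> [[[V0 VD] VM]|[V0 VD VM]].
  split; first by move: V0; rewrite inE.
    by move=> c x y Vx Vy; have := VD c x y; rewrite !inE; exact.
  by move=> x y Vx Vy; have := VM x y; rewrite !inE; exact.
split; first split; first by rewrite inE.
  by move=> c x y; rewrite !inE; exact: VD.
by move=> x y; rewrite !inE; exact: VM.
Qed.

Section Closure.
Variable V : set cseq.
Hypothesis V_subalg : subalgebra V.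

Lemma subalgebra0 : V 0. Proof. by have /subalgebraP[] := V_subalg. Qed.

Lemma subalgebraM x y : V x -> V y -> V (x * y).
Proof. by have /subalgebraP[_ _] := V_subalg; apply. Qed.

Lemma subalgebraZ (c : R[i]) x : V x -> V (c *: x).
Proof.
have /subalgebraP[V0 VD _] := V_subalg.
by move=> Vx; rewrite -[_ *: _]addr0; exact: VD.
Qed.

Lemma subalgebraB x y : V x -> V y -> V (x - y).
Proof.
have /subalgebraP[V0 VD _] := V_subalg.
by move=> Vx Vy; rewrite addrC -scaleN1r; exact: VD.
Qed.

End Closure.

Definition vanish N f := forall n, (n < N)%N -> f n = 0.

(** Vanishing at one more coordinate is a single linear condition, hence
    lowers the dimension by at most one: if some [b0] violates it, a spanning
    family is completed by [b0]. *)
Lemma finite_dimensional_vanish V N : subalgebra V ->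
  finite_dimensional [set f | V f /\ vanish N.+1 f] ->
  finite_dimensional [set f | V f /\ vanish N f].
Proof.
move=> VA [n [b [bV bspan]]].
have [[b0 [Vb0 b0N] b0n0]|nob] :=
  pselect (exists2 b0, V b0 /\ vanish N b0 & b0 N != 0); last first.
  exists n, b; split=> [i|x [Vx xN]].
    by have [Vb bN] := bV i; split=> // k kN; apply: bN; exact: ltnW.
  apply: bspan; split=> // k; rewrite ltnS leq_eqVlt => /predU1P[->|]; last exact: xN.
  by apply/eqP/negPn/negP => xn0; apply: nob; exists x.
exists n.+1, (fun i => if unlift ord0 i is Some j then b j else b0); split.
  move=> i; case: unliftP => [j _|_]; last by [].
  by have [Vb bN] := bV j; split=> // k kN; apply: bN; exact: ltnW.
move=> x [Vx xN].
have [|c E] := bspan (x - (x N / b0 N) *: b0).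
  split; first by apply: subalgebraB => //; exact: subalgebraZ.
  move=> k; rewrite -[(_ - _) k]/(x k - (x N / b0 N) * b0 k).
  rewrite ltnS leq_eqVlt => /predU1P[->|kN]; first by rewrite divfK// subrr.
  by rewrite (xN k kN) (b0N k kN) mulr0 subr0.
exists (fun i => if unlift ord0 i is Some j then c j else x N / b0 N).
rewrite big_ord_recl unlift_none.
under eq_bigr do rewrite liftK.
by rewrite -E addrC subrK.
Qed.

Lemma infinite_dimensional_vanish V N : subalgebra V ->
  infinite_dimensional V -> exists2 f, V f /\ vanish N f & f != 0.
Proof.
move=> VA Vinf; apply: contrapT => nof; apply: Vinf.
have : finite_dimensional [set f | V f /\ vanish N f].
  exists 0%N, (fun=> 0); split=> [[]|x [Vx xN]] //; exists (fun=> 0).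
  rewrite big_ord0; apply/eqP/negPn/negP => xn0; apply: nof.
  by exists x.
elim: N {nof} => [|N IH] fd; last by apply: IH; exact: finite_dimensional_vanish.
suff <- : [set f | V f /\ vanish 0 f] = V by [].
by apply/seteqP; split=> [f []|f Vf] //; split.
Qed.

(** The functions vanishing at almost all [n_ j] form an increasing union of
    the subalgebras [C_ K]; since [g K] is not in [C_ K], no finite set
    generates the union. *)
Lemma algebrable_of_staircase V (n_ : nat -> nat) (g : nat -> cseq) :
  subalgebra V -> (forall j, (n_ j < n_ j.+1)%N) ->
  (forall k, V (g k)) -> (forall k, g k (n_ k) != 0) ->
  (forall k j, (k < j)%N -> g k (n_ j) = 0) ->
  algebrable (V `\` Zset V) V.
Proof.
move=> VA n_incr gV gn0 g0.
pose C_ K := [set f | V f /\ forall j, (K <= j)%N -> f (n_ j) = 0].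
pose C := \bigcup_K C_ K.
have C_alg K : subalgebra (C_ K).
  apply/subalgebraP; have /subalgebraP[V0 VD VM] := VA; split=> [|c x y|x y].
  - by split.
  - move=> [Vx x0] [Vy y0]; split; first exact: VD.
    move=> j Kj; rewrite -[LHS]/(c * x (n_ j) + y (n_ j)).
    by rewrite x0// y0// mulr0 addr0.
  - move=> [Vx x0] [Vy y0]; split; first exact: VM.
    by move=> j Kj; rewrite -[LHS]/(x (n_ j) * y (n_ j)) x0// mul0r.
have C_mono K L : (K <= L)%N -> C_ K `<=` C_ L.
  by move=> KL f [Vf f0]; split=> // j Lj; apply: f0; exact: leq_trans Lj.
have CA : subalgebra C.
  apply/subalgebraP; split.
  - by exists 0%N => //; exact: subalgebra0.
  - move=> c x y [K _ xK] [L _ yL]; exists (maxn K L) => //.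
    have /subalgebraP[_ + _] := C_alg (maxn K L); apply.
      by apply: C_mono xK; exact: leq_maxl.
    by apply: C_mono yL; exact: leq_maxr.
  - move=> x y [K _ xK] [L _ yL]; exists (maxn K L) => //.
    apply: subalgebraM => //.
      by apply: C_mono xK; exact: leq_maxl.
    by apply: C_mono yL; exact: leq_maxr.
have n_ge j : (j <= n_ j)%N by elim: j => // j IH; exact: leq_ltn_trans IH _.
exists C; split => //.
- by move=> f [K _ []].
- move=> f [K _ [Vf f0]]; left; split=> // -[_ fin].
  have [||B zB] := finite_sub_bigcup (C := fun K => [set n | (n <= K)%N]) _ fin.
    by move=> K' L KL n /= nK; exact: leq_trans KL.
    by move=> n _; exists n => /=.
  have := zB _ (f0 (maxn K B.+1) (leq_maxl _ _)).
  by rewrite /= leqNgt (leq_trans _ (n_ge _))// leq_maxr.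
- move=> S [SC SE] Sfin.
  have [K SK] : exists K, S `<=` C_ K by exact: finite_sub_bigcup.
  have : C_ K (g K).
    have : C (g K) by exists K.+1 => //; split=> // j; exact: g0.
    by rewrite -SE; apply; split=> //; split=> // f Cf; exists K.
  by move=> [_ gK0]; have := gn0 K; rewrite (gK0 K (leqnn K)) eqxx.
Qed.
End Algebra.

(** * The gliding hump *)

Section Gliding.
Variable R : realType.
Local Notation cseq := (nat -> R[i]).
Local Notation normc := (@ComplexField.Normc.normc R).
Implicit Types (V W : set cseq) (x y f : cseq).

Lemma lp_normBC (p : \bar R) x y : (1 <= p)%E ->
  (lp_norm p (x - y)%R <= lp_norm p (y - x)%R)%E.
Proof.
by move=> p1; apply: lp_norm_le => // n; rewrite -opprB (normcN ((y - x) n)).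
Qed.

Lemma lp_norm0 (p : \bar R) : (1 <= p)%E -> lp_norm p (0 : cseq) = 0%E.
Proof.
move=> p1; rewrite /lp_norm -(@Lnorm0 _ nat R counting p).
  by apply: eq_Lnorm => n; rewrite ComplexField.Normc.normc0.
by rewrite gt_eqF// (lt_le_trans _ p1).
Qed.

Lemma exists_expr_half_lt (e : R) : 0 < e -> exists i, 2^-1 ^+ i < e.
Proof.
move=> e0; have ei0 : 0 <= e^-1 by rewrite invr_ge0 ltW.
exists (Num.bound e^-1); rewrite exprVn invf_plt ?posrE ?exprn_gt0//.
apply: lt_trans (archi_boundP ei0) _.
by rewrite -natrX ltr_nat ltn_expl.
Qed.

(** What one stage of the gliding hump needs: an index [n] beyond [N] where a
    new function [h] can start and where finitely many given functions [s k]
    can be made to vanish by subtracting a small [d], without changing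
    anything before [N]. *)
Definition correctable (p : \bar R) W := forall N i (s : nat -> cseq) (e : R),
  0 < e -> (forall k, (k < i)%N -> W (s k)) ->
  exists n, [/\ (N <= n)%N, (exists2 h, W h & vanish N h /\ h n != 0) &
    forall k, (k < i)%N -> exists d,
      [/\ W d, vanish N d, d n = s k n & (lp_norm p d <= e%:E)%E]].

(** The set [W] replaces [V] during the construction because for the supremum
    norm it consists of functions that tend to zero along an ultrafilter; the
    limits [g k] are only claimed to be in [V]. *)
Lemma staircase p V W : (1 <= p)%E -> V `<=` lp p -> lp_closed p V ->
  W `<=` V -> (forall x y, W x -> W y -> W (x - y)) -> correctable p W ->
  exists (n_ : nat -> nat) (g : nat -> cseq),
    [/\ forall j, (n_ j < n_ j.+1)%N, forall k, V (g k),
        forall k, g k (n_ k) != 0 &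
        forall k j, (k < j)%N -> g k (n_ j) = 0].
Proof.
move=> p1 V_lp V_closed WV WB corr.
have half0 i : 0 < 2^-1 ^+ i :> R by rewrite exprn_gt0.
(* A state consists of the stage [i], the length [N] of the segment on which
   values are final, and approximations [s k] for [k < i]. *)
have step (t : nat * nat * (nat -> cseq)) : exists u : nat * (nat -> cseq),
    let: (i, N, s) := t in let: (n, s') := u in
    (forall k, (k < i)%N -> W (s k)) ->
    [/\ (N <= n)%N, W (s' i), s' i n != 0 & forall k, (k < i)%N ->
      [/\ W (s' k), vanish N (s' k - s k), s' k n = 0 &
          (lp_norm p (s' k - s k)%R <= (2^-1 ^+ i.+1)%:E)%E]].
  case: t => [[i N] s].
  have [Ws|nWs] := pselect (forall k, (k < i)%N -> W (s k)); last first.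
    by exists (0%N, s).
  have [n [Nn [h Wh [hN hn]] Hd]] := corr N i s _ (half0 i.+1) Ws.
  have {}Hd k : exists d : cseq, (k < i)%N ->
      [/\ W d, vanish N d, d n = s k n & (lp_norm p d <= (2^-1 ^+ i.+1)%:E)%E].
    by have [/Hd[d dP]|ki] := boolP (k < i)%N; [exists d | exists 0].
  have [d dP] := choice Hd.
  exists (n, fun k => if (k < i)%N then s k - d k else h) => _.
  split=> // [||k ki]; rewrite ?ltnn// ki.
  have [Wd dN dn dp] := dP k ki; split.
  - by apply: WB => //; exact: Ws.
  - by move=> m mN; rewrite addrAC subrr add0r -[LHS]/(- d k m) dN// oppr0.
  - by rewrite -[LHS]/(s k n - d k n) dn subrr.
  - rewrite addrAC subrr add0r -(sub0r (d k)).
    by apply: le_trans (lp_normBC _ _ p1) _; rewrite subr0.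
have [F HF] := choice step.
pose st := fix st i := if i is j.+1 then
    let u := F (j, (st j).1, (st j).2) in (u.1.+1, u.2)
  else (0%N, fun _ : nat => 0 : cseq).
pose N_ i := (st i).1; pose S_ i := (st i).2.
pose n_ i := (F (i, N_ i, S_ i)).1.
have NS i : N_ i.+1 = (n_ i).+1 by [].
have stepE i : (forall k, (k < i)%N -> W (S_ i k)) ->
    [/\ (N_ i <= n_ i)%N, W (S_ i.+1 i), S_ i.+1 i (n_ i) != 0 & forall k, (k < i)%N ->
      [/\ W (S_ i.+1 k), vanish (N_ i) (S_ i.+1 k - S_ i k), S_ i.+1 k (n_ i) = 0 &
          (lp_norm p (S_ i.+1 k - S_ i k)%R <= (2^-1 ^+ i.+1)%:E)%E]].
  have := HF (i, N_ i, S_ i).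
  have -> : S_ i.+1 = (F (i, N_ i, S_ i)).2 by [].
  have -> : n_ i = (F (i, N_ i, S_ i)).1 by [].
  by case: (F _).
have WS i k : (k < i)%N -> W (S_ i k).
  elim: i k => // i IH k; have [_ Wi _ H] := stepE i IH.
  by rewrite ltnS leq_eqVlt => /predU1P[->//|/H[]].
have {}stepE i := stepE i (WS i).
have N_n i : (N_ i <= n_ i)%N by have [] := stepE i.
have N_mono : {homo N_ : i j / (i <= j)%N}.
  by apply: homo_leq leqnn leq_trans _ => i; rewrite NS ltnW// ltnS.
have N_ge i : (i <= N_ i)%N.
  by elim: i => // i IH; rewrite NS ltnS; exact: leq_trans (N_n i).
have S_stable k i m : (k < i)%N -> (i <= m)%N -> forall n, (n < N_ i)%N ->
    S_ m k n = S_ i k n.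
  move=> ki; elim: m => [|m IH] im n nN.
    by have -> : i = 0%N by apply/eqP; rewrite -leqn0.
  move: im; rewrite leq_eqVlt => /predU1P[->//|]; rewrite ltnS => im.
  rewrite -(IH im n nN); apply/eqP; rewrite -subr_eq0; apply/eqP.
  have [_ _ _ /(_ k (leq_trans ki im))[_ H _ _]] := stepE m.
  by apply: H; apply: leq_trans nN _; exact: N_mono.
have S_close k i m : (k < i)%N -> (i <= m)%N ->
    (lp_norm p (S_ m k - S_ i k)%R <= (2^-1 ^+ i - 2^-1 ^+ m)%:E)%E.
  move=> ki; elim: m => [|m IH] im.
    move: ki; suff -> : i = 0%N by []. by apply/eqP; rewrite -leqn0.
  move: im; rewrite leq_eqVlt => /predU1P[->|].
    by rewrite !subrr lp_norm0.
  rewrite ltnS => im.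
  have -> : S_ m.+1 k - S_ i k = (S_ m.+1 k - S_ m k) + (S_ m k - S_ i k).
    by rewrite addrA subrK.
  apply: le_trans (lp_normD _ _ p1) _.
  have [_ _ _ /(_ k (leq_trans ki im))[_ _ _ H]] := stepE m.
  apply: le_trans (leeD H (IH im)) _.
  rewrite -EFinD lee_fin.
  have -> : 2^-1 ^+ m = 2^-1 ^+ m.+1 * 2 :> R by rewrite exprS mulrC mulrA divff ?mul1r.
  lra.
(* The value at [n] is final from stage [n.+1] on, since [n < N_ n.+1], and
   the approximation number [k] exists from stage [k.+1] on. *)
pose g k : cseq := fun n => S_ (maxn k n).+1 k n.
have gE k i n : (k < i)%N -> (n < N_ i)%N -> g k n = S_ i k n.
  move=> ki nN; rewrite /g.
  have [le|lt] := leqP i (maxn k n).+1; first exact: S_stable.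
  apply/esym/S_stable; [exact: leq_maxl | exact: ltnW |].
  by apply: leq_trans (N_ge _); exact: leq_maxr.
have g_close k i : (k < i)%N -> (lp_norm p (g k - S_ i k)%R <= (2^-1 ^+ i)%:E)%E.
  move=> ki; apply: lp_norm_local => [//||M]; first exact: ltW.
  exists (S_ (maxn i M) k - S_ i k).
    move=> n nM; rewrite -[LHS]/(S_ (maxn i M) k n - S_ i k n).
    rewrite -(gE k (maxn i M))// ?leq_max ?ki//.
    apply: leq_trans nM _; apply: leq_trans (N_ge M) _; apply: N_mono.
    exact: leq_maxr.
  apply: le_trans (S_close k i (maxn i M) ki (leq_maxl _ _)) _.
  by rewrite lee_fin gerBl ltW.
exists n_, g; split.
- by move=> j; apply: leq_trans (N_n j.+1); rewrite NS.
- move=> k; apply: V_closed.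
    rewrite /lp/= -(subrK (S_ k.+1 k) (g k)).
    apply: le_lt_trans (lp_normD _ _ p1) _; apply: lte_add_pinfty.
      by apply: le_lt_trans (g_close k k.+1 (leqnn _)) _; rewrite ltry.
    by apply: V_lp; apply: WV; exact: WS.
  move=> e e0; have [i ie] := exists_expr_half_lt e0.
  exists (S_ (maxn i k.+1) k); first by apply/WV/WS; rewrite leq_maxr.
  apply: le_lt_trans (g_close k _ _) _; first by rewrite leq_maxr.
  rewrite lte_fin; apply: le_lt_trans ie.
  by apply: ler_wiXn2l; rewrite ?leq_maxl ?invr_ge0 ?invf_le1 ?ler1n.
- move=> k; rewrite (gE k k.+1) ?NS//; by have [] := stepE k.
- move=> k j kj; rewrite (gE k j.+1) ?NS// ?ltnS ?(ltnW kj)//.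
  by have [_ _ _ /(_ k kj)[]] := stepE j.
Qed.
End Gliding.

(** * Peaking functions, and the case of finite exponent *)

Section Peaks.
Variable R : realType.
Local Notation cseq := (nat -> R[i]).
Local Notation normc := (@ComplexField.Normc.normc R).
Implicit Types (V W : set cseq) (x y f : cseq).

Lemma exists_almost_max f (a : R) : (forall n, normc (f n) <= a) -> f != 0 ->
  exists2 n, f n != 0 & forall m, normc (f m) <= 2 * normc (f n).
Proof.
move=> fa f0.
pose E := [set normc (f n) | n in [set: nat]].
have [n0 fn0] : exists n, f n != 0.
  apply: contrapT => nf; move/eqP: f0; apply; apply/funext => n.
  by apply/eqP/negPn/negP => fn; apply: nf; exists n.
have fn0_gt0 : 0 < normc (f n0).
  rewrite lt_def normc_ge0 andbT; apply: contra fn0 => /eqP.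
  by move=> /ComplexField.Normc.eq0_normc ->.
have Esup : has_sup E.
  by split; [exists (normc (f n0)), n0|exists a => _ [n _ <-]].
have supE m : normc (f m) <= sup E by apply: sup_upper_bound => //; exists m.
have sup_gt0 : 0 < sup E by exact: lt_le_trans (supE n0).
have [_ [n _ <-] fn] := sup_adherent (divr_gt0 sup_gt0 (ltr0n _ 2)) Esup.
have sup_fn : sup E < 2 * normc (f n) by lra.
exists n; last by move=> m; apply: le_trans (supE m) _; exact: ltW.
by apply: contraTneq sup_fn => ->; rewrite ComplexField.Normc.normc0 mulr0 -leNgt ltW.
Qed.

(** The supremum of [|f|] need not be attained; a coordinate where [|f|]
    exceeds half of it gives the bound [2] after normalisation. *)
Lemma exists_peak p V N : (1 <= p)%E -> V `<=` lp p -> subalgebra V ->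
  infinite_dimensional V ->
  exists f n, [/\ V f, vanish N f, f n = 1 & forall m, normc (f m) <= 2].
Proof.
move=> p1 Vp VA Vinf.
have [f [Vf fN] f0] := infinite_dimensional_vanish N VA Vinf.
have [a fa] := lp_bounded p1 (Vp _ Vf).
have [n fn fmax] := exists_almost_max fa f0.
exists ((f n)^-1 *: f), n; split.
- exact: subalgebraZ.
- by move=> m mN; rewrite -[LHS]/((f n)^-1 * f m) (fN m mN) mulr0.
- by rewrite -[LHS]/((f n)^-1 * f n) mulVf.
move=> m; rewrite -[X in normc X]/((f n)^-1 * f m).
rewrite ComplexField.Normc.normcM ComplexField.Normc.normcV mulrC.
rewrite ler_pdivrMr; first exact: fmax.
rewrite lt_def normc_ge0 andbT; apply: contra fn => /eqP.
by move=> /ComplexField.Normc.eq0_normc ->.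
Qed.

Lemma vanish_neq0_le N f n : vanish N f -> f n != 0 -> (N <= n)%N.
Proof. by move=> fN; apply: contraR; rewrite -ltnNge => /fN ->. Qed.

Lemma vanishM N f x : vanish N f -> vanish N (x * f).
Proof. by move=> fN n nN; rewrite -[LHS]/(x n * f n) (fN n nN) mulr0. Qed.

(** The product of [s k] with a peaking function is bounded by the tail of
    [2 *: s k] beyond the segment where the latter vanishes. *)
Lemma correctable_fin (r : R) V : 1 <= r -> V `<=` lp r%:E -> subalgebra V ->
  infinite_dimensional V -> correctable r%:E V.
Proof.
move=> r1 Vp VA Vinf N i s e e0 Vs.
have p1 : (1 <= r%:E)%E by rewrite lee_fin.
have [M NM tailM] : exists2 M, (N <= M)%N & forall k, (k < i)%N ->
    (lp_norm r%:E (tail M (2 *: s k)%R) <= e%:E)%E.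
  elim: i Vs => [|i IH] Vs; first by exists N.
  have [M NM tM] := IH (fun k ki => Vs k (ltnW ki)).
  have [L tL] := lp_tail r1 (Vp _ (subalgebraZ VA 2 (Vs i (leqnn _)))) e0.
  exists (maxn M L); first by rewrite leq_max NM.
  move=> k; rewrite ltnS leq_eqVlt => /predU1P[->|ki].
    by apply: tL; exact: leq_maxr.
  apply: le_trans (tM k ki); apply: lp_norm_le => // n; rewrite /tail.
  case: ifPn; first by rewrite geq_max => /andP[->].
  by rewrite ComplexField.Normc.normc0 normc_ge0.
have [f [n [Vf fM fn f2]]] := exists_peak M p1 Vp VA Vinf.
have fn0 : f n != 0 by rewrite fn oner_neq0.
have fN : vanish N f by move=> m mN; apply: fM; exact: leq_trans NM.
exists n; split; first exact: vanish_neq0_le fn0.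
  by exists f.
move=> k ki; exists (s k * f); split.
- by apply: subalgebraM => //; exact: Vs.
- exact: vanishM.
- by rewrite -[LHS]/(s k n * f n) fn mulr1.
apply: le_trans (tailM k ki); apply: lp_norm_le => // m.
rewrite -[X in normc X <= _]/(s k m * f m) ComplexField.Normc.normcM.
have [mM|Mm] := ltnP m M.
  by rewrite (fM m mM) ComplexField.Normc.normc0 mulr0 normc_ge0.
rewrite /tail Mm -[X in _ <= normc X]/(2 * s k m) ComplexField.Normc.normcM.
rewrite mulrC; apply: ler_pM; rewrite ?normc_ge0//.
apply: le_trans (f2 m) _.
by rewrite (normcMn 1 2) ComplexField.Normc.normc1.
Qed.

End Peaks.

(** * Limits along an ultrafilter *)

Section UltraLimit.
Variable R : realType.
Local Notation cseq := (nat -> R[i]).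
Local Notation normc := (@ComplexField.Normc.normc R).
Variable U : set_system nat.
Hypothesis U_ultra : UltraFilter U.
Implicit Types (x y f : cseq).

(** The limit is the supremum of the numbers [t] that are eventually below [a]:
    since [U] is an ultrafilter, a number not in this set is eventually above
    [a]. *)
Lemma ultra_lim_real (a : nat -> R) (B : R) : (forall n, `|a n| <= B) ->
  exists l : R, forall e, 0 < e -> U [set n | `|a n - l| < e].
Proof.
move=> aB; pose E := [set t | U [set n | t <= a n]].
have Esup : has_sup E.
  split.
    exists (- B); rewrite /E/=; apply: filterS filterT => n _ /=.
    by have := aB n; rewrite ler_norml => /andP[].
  exists B => t /filter_ex[n /= tn]; apply: le_trans tn _.
  by have := aB n; rewrite ler_norml => /andP[].
exists (sup E) => e e0.
have [t Et lt_t] := sup_adherent e0 Esup.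
have Ut : U [set n | a n < sup E + e].
  have [H|H] := in_ultra_setVsetC [set n | sup E + e <= a n] U_ultra.
    have : sup E + e <= sup E by exact: sup_upper_bound.
    by rewrite gerDl leNgt e0.
  by apply: filterS H => n /= /negP; rewrite -ltNge.
apply: filterS (filterI Et Ut) => n /= [t_n n_t].
by rewrite ltr_norml; apply/andP; split; lra.
Qed.

Definition ultra_null f := forall e : R, 0 < e -> U [set n | normc (f n) < e].

Lemma ultra_nullB f x : ultra_null f -> ultra_null x -> ultra_null (f - x).
Proof.
move=> f0 x0 e e0; have e2 : 0 < e / 2 by rewrite divr_gt0.
apply: filterS (filterI (f0 _ e2) (x0 _ e2)) => n /= [fn xn].
rewrite -[X in normc X]/(f n - x n); apply: le_lt_trans (le_normcD _ _) _.
by rewrite normcN [ltRHS]splitr ltrD.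
Qed.

Lemma ultra_nullM f x (B : R) : (forall n, normc (x n) <= B) ->
  ultra_null f -> ultra_null (x * f).
Proof.
move=> xB f0 e e0.
have B1 : 0 < `|B| + 1 by rewrite ltr_wpDl.
apply: filterS (f0 _ (divr_gt0 e0 B1)) => n /=.
rewrite -[X in _ -> normc X < _]/(x n * f n) ComplexField.Normc.normcM.
rewrite ltr_pdivlMr// mulrC; apply: le_lt_trans.
apply: ler_wpM2r; rewrite ?normc_ge0//; apply: le_trans (xB n) _.
by apply: le_trans (ler_norm _) _; rewrite lerDl.
Qed.

Lemma normc_le_ReIm (z : R[i]) : normc z <= `|complex.Re z| + `|complex.Im z|.
Proof.
case: z => a b /=; rewrite -[leRHS]ger0_norm ?addr_ge0// -sqrtr_sqr.
by apply: ler_wsqrtr; rewrite sqrrD !real_normK ?num_real// -addrA lerD2l lerDr mulrn_wge0// mulr_ge0.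
Qed.

Lemma Re_le_normc (z : R[i]) : `|complex.Re z| <= normc z.
Proof. by case: z => a b /=; rewrite -sqrtr_sqr; apply: ler_wsqrtr; rewrite lerDl sqr_ge0. Qed.

Lemma Im_le_normc (z : R[i]) : `|complex.Im z| <= normc z.
Proof. by case: z => a b /=; rewrite -sqrtr_sqr; apply: ler_wsqrtr; rewrite lerDr sqr_ge0. Qed.

Lemma ultra_lim f (B : R) : (forall n, normc (f n) <= B) ->
  exists2 l : R[i], ultra_null (fun n => f n - l) & normc l <= B.
Proof.
move=> fB.
have [|a Ha] := @ultra_lim_real (fun n => complex.Re (f n)) B.
  by move=> n; exact: le_trans (Re_le_normc _) (fB n).
have [|b Hb] := @ultra_lim_real (fun n => complex.Im (f n)) B.
  by move=> n; exact: le_trans (Im_le_normc _) (fB n).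
have null : ultra_null (fun n => f n - (a +i* b)%C).
  move=> e e0; have e2 : 0 < e / 2 by rewrite divr_gt0.
  apply: filterS (filterI (Ha _ e2) (Hb _ e2)) => n /= [an bn].
  apply: le_lt_trans (normc_le_ReIm _) _; rewrite [ltRHS]splitr.
  by move: an bn; case: (f n) => u v /= an bn; rewrite ltrD.
move: (a +i* b)%C null => l null; exists l => //.
apply/ler_addgt0Pr => e e0; have [n /= fn] := filter_ex (null e e0).
rewrite -[X in normc X](subrK (f n)).
apply: le_trans (le_normcD _ _) _; rewrite addrC lerD//.
by rewrite -normcN opprB ltW.
Qed.

End UltraLimit.

(** * The case of the supremum norm *)

Section SupNorm.
Variable R : realType.
Local Notation cseq := (nat -> R[i]).
Local Notation normc := (@ComplexField.Normc.normc R).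
Variable V : set cseq.
Hypothesis V_lp : V `<=` lp +oo.
Hypothesis V_subalg : subalgebra V.
Hypothesis V_dim : infinite_dimensional V.

Definition peak_at N f n :=
  [/\ V f, vanish N f, f n = 1 & forall m, normc (f m) <= 2].

Definition peaks N := [set n | exists f, peak_at N f n].

(** The sets of peaks decrease with [N] and are not empty, hence generate a
    proper filter. *)
Lemma exists_peak_ultrafilter : exists2 U, UltraFilter U & forall N, U (peaks N).
Proof.
have PF : ProperFilter (filter_from setT peaks).
  apply: filter_from_proper => [|N _]; last first.
    by have [f [n fn]] := exists_peak N (leey _) V_lp V_subalg V_dim; exists n, f.
  apply: filter_fromT_filter; first by exists 0%N.
  move=> M N; exists (maxn M N) => n [f [Vf fN fn f2]].
  by split; exists f; split=> // m mN; apply: fN; rewrite leq_max mN ?orbT.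
have [U [UU PU]] := ultraFilterLemma PF.
by exists U => // N; apply: PU; exists N.
Qed.

Variable U : set_system nat.
Hypothesis U_ultra : UltraFilter U.
Hypothesis U_peaks : forall N, U (peaks N).

Let W : set cseq := V `&` ultra_null U.

(** The function [f * (f - l)] tends to zero along [U], vanishes where [f] does,
    and its value [1 - l] at [n] is bounded below, so that dividing by
    it keeps the bound uniform. *)
Lemma peak_square N f n (l : R[i]) : peak_at N f n ->
  ultra_null U (fun m => f m - l) -> normc l <= 2 -> 2^-1 <= normc (1 - l) ->
  exists2 h, W h & [/\ vanish N h, h n = 1 & forall m, normc (h m) <= 16].
Proof.
move=> [Vf fN fn f2] fl l2 l1.
have nl0 : 0 < normc (1 - l) by apply: lt_le_trans l1.
have l10 : 1 - l != 0.
  by apply: contraTneq nl0 => ->; rewrite ComplexField.Normc.normc0 ltxx.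
have inv2 : normc (1 - l)^-1 <= 2.
  by rewrite ComplexField.Normc.normcV invf_ple ?posrE.
pose h := (1 - l)^-1 *: (f * f - l *: f).
have hE m : h m = ((1 - l)^-1 * f m) * (f m - l).
  rewrite -[h m]/((1 - l)^-1 * (f m * f m - l * f m)).
  by rewrite -mulrA [f m * (_ - _)]mulrBr [l * _]mulrC.
have bnd m : normc ((1 - l)^-1 * f m) <= 4.
  rewrite ComplexField.Normc.normcM -[4]/(2 * 2)%:R natrM.
  by apply: ler_pM; rewrite ?normc_ge0.
exists h; first split.
- apply: subalgebraZ => //; apply: subalgebraB => //; first exact: subalgebraM.
  exact: subalgebraZ.
- have -> : h = ((1 - l)^-1 *: f) * (fun m => f m - l) by apply/funext => m; exact: hE.
  by apply: ultra_nullM fl => // m; exact: bnd.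
split.
- by move=> m mN; rewrite hE (fN m mN) mulr0 mul0r.
- by rewrite hE fn mulr1 mulVf.
move=> m; rewrite hE ComplexField.Normc.normcM -[16]/(4 * 4)%:R natrM.
apply: ler_pM; rewrite ?normc_ge0//.
apply: le_trans (le_normcD _ _) _; rewrite normcN.
by apply: le_trans (lerD (f2 m) l2) _; lra.
Qed.

(** If the limit [l] of [f] is near [1], [peak_square] gives no uniform bound. A
    second peak [n'] is then taken after [n]: either [peak_square] applies to
    its function [f'], or its limit [l'] is also near [1], and subtracting
    [(l / l') *: f'], which vanishes at [n], cancels the limit of [f]. *)
Lemma exists_null_peak N A : U A -> exists n h,
  [/\ A n, W h, vanish N h, h n = 1 & forall m, normc (h m) <= 16].
Proof.
move=> UA.
have peakA M : exists n f l, [/\ A n, peak_at M f n,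
    ultra_null U (fun m => f m - l) & normc l <= 2].
  have [n [An [f fn]]] := filter_ex (filterI UA (U_peaks M)).
  have [_ _ _ f2] := fn; have [l lf l2] := ultra_lim U_ultra f2.
  by exists n, f, l.
have [n [f [l [An fn lf l2]]]] := peakA N.
have [l1|l1] := lerP 2^-1 (normc (1 - l)).
  by have [h Wh [hN hn h16]] := peak_square fn lf l2 l1; exists n, h.
have [n' [f' [l' [An' fn' lf' l2']]]] := peakA (maxn N n.+1).
have [l1'|l1'] := lerP 2^-1 (normc (1 - l')).
  have [h Wh [hN hn h16]] := peak_square fn' lf' l2' l1'.
  exists n', h; split=> // m mN; apply: hN; by rewrite leq_max mN.
have l'2 : 2^-1 < normc l'.
  have := le_normcD (1 - l') l'; rewrite subrK ComplexField.Normc.normc1; lra.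
have l'0 : l' != 0.
  by apply: contraTneq l'2 => ->; rewrite ComplexField.Normc.normc0 -leNgt invr_ge0.
have c4 : normc (l / l') <= 4.
  rewrite ComplexField.Normc.normcM ComplexField.Normc.normcV ler_pdivrMr; first lra.
  by apply: lt_trans l'2; rewrite invr_gt0.
have [Vf fN fn1 f2] := fn; have [Vf' fN' fn1' f2'] := fn'.
exists n, (f - (l / l') *: f'); split=> //.
- split; first by apply: subalgebraB => //; exact: subalgebraZ.
  have -> : f - (l / l') *: f' =
      (fun m => f m - l) - (fun=> l / l') * (fun m => f' m - l').
    apply/funext => m; rewrite -[LHS]/(f m - l / l' * f' m).
    rewrite -[RHS]/(f m - l - l / l' * (f' m - l')).
    by rewrite mulrBr divfK// opprB addrA subrK.
  by apply: ultra_nullB => //; apply: ultra_nullM lf' => // m; exact: c4.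
- move=> m mN; rewrite -[LHS]/(f m - l / l' * f' m).
  by rewrite (fN m mN) (fN' m) ?leq_max ?mN// mulr0 subrr.
- rewrite -[LHS]/(f n - l / l' * f' n).
  by rewrite fn1 (fN' n) ?leq_max ?leqnn ?orbT// mulr0 subr0.
move=> m; rewrite -[X in normc X]/(f m - l / l' * f' m).
apply: le_trans (le_normcD _ _) _; rewrite normcN ComplexField.Normc.normcM.
have : normc (l / l') * normc (f' m) <= 4 * 2 by apply: ler_pM; rewrite ?normc_ge0.
by have := f2 m; lra.
Qed.

Lemma correctable_sup : correctable +oo W.
Proof.
move=> N i s e e0 Ws.
have e16 : 0 < e / 16 by rewrite divr_gt0.
have UA : U [set n | forall k, (k < i)%N -> normc (s k n) < e / 16].
  elim: i Ws => [|i IH] Ws; first by apply: filterS filterT.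
  have [_ si0] := Ws i (leqnn _).
  apply: filterS (filterI (IH (fun k ki => Ws k (ltnW ki))) (si0 _ e16)).
  by move=> n /= [H Hi] k; rewrite ltnS leq_eqVlt => /predU1P[->//|]; exact: H.
have [n [h [An [Vh h0] hN hn h16]]] := exists_null_peak N UA.
have hn0 : h n != 0 by rewrite hn oner_neq0.
exists n; split; first exact: vanish_neq0_le hn0.
  by exists h.
move=> k ki; exists (s k n *: h); split.
- split; first exact: subalgebraZ.
  by apply: (@ultra_nullM _ _ _ h (fun=> s k n) (normc (s k n))).
- by move=> m mN; rewrite -[LHS]/(s k n * h m) (hN m mN) mulr0.
- by rewrite -[LHS]/(s k n * h n) hn mulr1.
apply/lp_norm_sup_leP => m; rewrite -[X in normc X]/(s k n * h m).
rewrite ComplexField.Normc.normcM.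
have -> : e = e / 16 * 16 by rewrite divfK.
by apply: ler_pM; rewrite ?normc_ge0// ltW// An.
Qed.

Lemma ultra_null_subB x y : W x -> W y -> W (x - y).
Proof.
by move=> [Vx x0] [Vy y0]; split; [exact: subalgebraB|exact: ultra_nullB].
Qed.

End SupNorm.

(** * Algebrability *)

Theorem theorem5p3 (R : realType) (p : \bar R) (hp : (1 <= p)%E)
    (V : set (nat -> R[i])) (V_lp : V `<=` lp p) (V_subalg : subalgebra V)
    (V_closed : lp_closed p V) (V_dim : infinite_dimensional V) :
  algebrable (V `\` Zset V) V.
Proof.
have [W [WV WB Wcorr]] : exists W, [/\ W `<=` V,
    (forall x y, W x -> W y -> W (x - y)) & correctable p W].
  case: p hp V_lp V_closed => [r||]// r1 Vp _.
    exists V; split=> //; first by move=> x y; exact: subalgebraB.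
    by apply: correctable_fin; rewrite -?lee_fin.
  have [U UU Upeaks] := exists_peak_ultrafilter Vp V_subalg V_dim.
  exists (V `&` ultra_null U); split; first by move=> x [].
    by move=> x y; exact: ultra_null_subB.
  exact: correctable_sup.
have [n_ [g [n_incr gV gn0 g0]]] := staircase hp V_lp V_closed WV WB Wcorr.
exact: (algebrable_of_staircase V_subalg n_incr gV gn0 g0).
Qed.
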